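(* Let $A$ be an abelian variety over $\mathbb C$ of dimension $g$, embedded as a smooth projective variety in $\mathbb CP^k$, and let $\pi:\mathbb C^g\to\mathbb C^g/\Lambda\simeq A$ be the quotient map, where $\Lambda\subset\mathbb C^g$ is a lattice of rank $2g$. Let $x=(x_1,\ldots,x_k)$ be a set of affine coordinates corresponding to an affine subspace $\mathbb C^k\subset\mathbb CP^k$, and set $f_j:=x_j\circ\pi$ for $j=1,\ldots,k$. Then $f_1,\ldots,f_k$ are complex Noetherian functions of the variables $z=(z_1,\ldots,z_g)\in\mathbb C^g$ away from the polar locus, i.e. on every bounded domain $\Omega$ whose closure is contained in $\pi^{-1}(A\cap\mathbb C^k)$.
   Context: Complex Noetherian functions: for a bounded domain $\Omega\subset\mathbb C^n$ with coordinates $x$, a tuple of holomorphic functions $\phi=(\phi_1,\ldots,\phi_\ell):\Omega\to\mathbb C^\ell$ is a complex Noetherian chain if $\partial\phi_i/\partial x_j=P_{i,j}(x,\phi)$ for all $i,j$, with $P_{i,j}$ complex polynomials. A function on $\Omega$ is a complex Noetherian function if it has the form $P(x,\phi)$ for some complex Noetherian chain $\phi$ on $\Omega$ and some complex polynomial $P$. *)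

(* Defs.v *)
From HB Require Import structures.
From mathcomp Require Import all_boot all_order all_algebra.
From mathcomp Require Import all_classical all_reals all_analysis.
From mathcomp Require Import complex.
(* The notations of mpoly clash with those of analysis. *)
From mathcomp Require Import(canonicals, coercions, hints) mpoly.

Set Implicit Arguments.
Unset Strict Implicit.
Unset Printing Implicit Defensive.

Import Order.TTheory GRing.Theory Num.Theory.
Import numFieldNormedType.Exports.

Local Open Scope classical_set_scope.
Local Open Scope ring_scope.
Local Open Scope complex_scope.

(* The norm topology on R[i], over which the derivatives below are taken:
   [differentiable] and ['D_v] are thus complex (Frechet, resp. directional)
   derivatives. *)
#[non_forgetful_inheritance]
HB.instance Definition _ (R : rcfType) :=
  PseudoPointedMetric.copy R[i] R[i]^o.
#[non_forgetful_inheritance]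
HB.instance Definition _ (R : rcfType) := GRing.ComAlgebra.copy R[i] R[i]^o.
#[non_forgetful_inheritance]
HB.instance Definition _ (R : rcfType) := Vector.copy R[i] R[i]^o.
#[non_forgetful_inheritance]
HB.instance Definition _ (R : rcfType) := NormedModule.copy R[i] R[i]^o.

Section NoetherianFunctions.
Variables (R : realType) (n : nat).
Implicit Types (Omega : set 'rV[R[i]]_n).

Definition bounded_domain Omega :=
  [/\ Omega !=set0, open Omega, connected Omega & bounded_set Omega].

(* The value P(x, phi(x)); the first n variables of P stand for x. *)
Definition eval_with l (phi : 'I_l -> 'rV[R[i]]_n -> R[i])
    (P : mpoly.mpoly (n + l) R[i]) (x : 'rV[R[i]]_n) : R[i] :=
  mpoly.meval (row_mx x (\row_i phi i x) 0) P.

Definition noetherian_chain Omega l (phi : 'I_l -> 'rV[R[i]]_n -> R[i]) :=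
  (forall i x, Omega x -> differentiable (phi i) x) /\
  exists P : 'I_l -> 'I_n -> mpoly.mpoly (n + l) R[i],
    forall i j x, Omega x ->
      'D_(delta_mx 0 j) (phi i) x = eval_with phi (P i j) x.

Definition noetherian_function Omega (f : 'rV[R[i]]_n -> R[i]) :=
  exists (l : nat) (phi : 'I_l -> 'rV[R[i]]_n -> R[i])
    (P : mpoly.mpoly (n + l) R[i]),
    noetherian_chain Omega phi /\
    forall x, Omega x -> f x = eval_with phi P x.

End NoetherianFunctions.

Section ProjectiveSpace.
Variables (R : realType) (k : nat).
Local Open Scope quotient_scope.

Definition nzvec := {v : 'rV[R[i]]_k.+1 | v != 0}.

Definition same_line (u v : nzvec) : bool := (val u == val v)%MS.

Lemma same_line_refl : reflexive same_line.
Proof. by move=> u; rewrite /same_line submx_refl. Qed.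

Lemma same_line_sym : symmetric same_line.
Proof. by move=> u v; rewrite /same_line andbC. Qed.

Lemma same_line_trans : transitive same_line.
Proof.
move=> v u w /andP[uv vu] /andP[vw wv].
by rewrite /same_line (submx_trans uv vw) (submx_trans wv vu).
Qed.

Canonical same_line_equiv :=
  EquivRel same_line same_line_refl same_line_sym same_line_trans.

(* Complex projective k-space. *)
Definition CP := {eq_quot same_line}.
HB.instance Definition _ : EqQuotient _ same_line CP := EqQuotient.on CP.
HB.instance Definition _ := Choice.on CP.

Lemma nzvec0_subproof : delta_mx 0 0 != 0 :> 'rV[R[i]]_k.+1.
Proof.
by apply/eqP => /matrixP/(_ 0 0)/eqP; rewrite !mxE !eqxx oner_eq0.
Qed.

Definition nzvec0 : nzvec :=
  exist (fun v : 'rV[R[i]]_k.+1 => v != 0) _ nzvec0_subproof.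

(* The point [v_0 : ... : v_k]; junk value if v = 0. *)
Definition pt (v : 'rV[R[i]]_k.+1) : CP :=
  \pi_CP (insubd nzvec0 v).

(* A chosen nonzero vector of homogeneous coordinates of p. *)
Definition hc (p : CP) : 'rV[R[i]]_k.+1 := val (repr p).

Lemma hc_neq0 p : hc p != 0.
Proof. exact: (valP (repr p)). Qed.

Lemma hcK : cancel hc pt.
Proof. by move=> p; rewrite /pt valKd reprK. Qed.

Lemma pt_eqP (u v : 'rV[R[i]]_k.+1) : u != 0 -> v != 0 ->
  reflect (exists2 c, c != 0 & u = c *: v) (pt u == pt v).
Proof.
move=> u0 v0; apply: (iffP idP) => [|[c c0 uE]].
  rewrite /pt /insubd !insubT eqquotE /= => /andP[/= /sub_rVP[c uE] _].
  by exists c => //; apply: contraNneq u0 => c0; rewrite uE c0 scale0r.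
rewrite /pt /insubd !insubT eqquotE /= /same_line /= uE.
by rewrite !eqmx_scale // submx_refl.
Qed.

Definition vanishes (P : mpoly.mpoly k.+1 R[i]) (p : CP) :=
  mpoly.meval (hc p 0) P = 0.

Definition homogeneous_of (d : nat) (P : mpoly.mpoly k.+1 R[i]) : Prop :=
  P \is mpoly.ishomog1 d (mpoly.Measure.clone _ (@mpoly.mdeg k.+1) _).

Definition homogeneous (P : mpoly.mpoly k.+1 R[i]) :=
  exists d, homogeneous_of d P.

Definition zariski_closed (Z : set CP) :=
  exists2 S : set (mpoly.mpoly k.+1 R[i]), S `<=` homogeneous &
    Z = [set p | forall P, S P -> vanishes P p].

Definition irreducible (Z : set CP) :=
  Z !=set0 /\ forall Z1 Z2, zariski_closed Z1 -> zariski_closed Z2 ->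
    Z `<=` Z1 `|` Z2 -> Z `<=` Z1 \/ Z `<=` Z2.

Definition projective_variety (Z : set CP) :=
  zariski_closed Z /\ irreducible Z.

Definition has_chain (Z : set CP) (n : nat) :=
  exists F : nat -> set CP,
    (forall i, (i <= n)%N -> projective_variety (F i) /\ F i `<=` Z) /\
    (forall i, (i < n)%N -> F i `<` F i.+1).

(* Krull dimension. *)
Definition dimension (Z : set CP) (n : nat) :=
  has_chain Z n /\ ~ has_chain Z n.+1.

(* The Zariski tangent space, at a point of the line p, of the affine cone
   over Z. *)
Definition cone_tangent (Z : set CP) (p : CP) : set 'rV[R[i]]_k.+1 :=
  [set w | forall P, homogeneous P -> (forall q, Z q -> vanishes P q) ->
    \sum_i mpoly.meval (hc p 0) (mpoly.mderiv i P) * w 0 i = 0].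

(* The Jacobian criterion: the Jacobian matrix of the homogeneous ideal of Z
   has rank k - n, i.e. a kernel of dimension n + 1, at each point of Z. *)
Definition smooth (Z : set CP) (n : nat) :=
  forall p, Z p -> exists2 T : 'M[R[i]]_k.+1, \rank T = n.+1 &
    forall w, cone_tangent Z p w <-> (w <= T)%MS.

Definition homog_map (H : 'I_k.+1 -> mpoly.mpoly k.+1 R[i]) (p : CP)
  : 'rV[R[i]]_k.+1 := \row_i mpoly.meval (hc p 0) (H i).

(* phi is locally on Z of the form [H_0 : ... : H_k] with H_i homogeneous of
   the same degree.  Asking for agreement wherever H != 0, rather than on some
   smaller Zariski neighbourhood {Q != 0} of p, is no restriction: replace H
   by Q H. *)
Definition regular_map (Z : set CP) (phi : CP -> CP) :=
  forall p, Z p ->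
    exists d (H : 'I_k.+1 -> mpoly.mpoly k.+1 R[i]),
    [/\ forall i, homogeneous_of d (H i),
        homog_map H p != 0 &
        forall q, Z q -> homog_map H q != 0 -> phi q = pt (homog_map H q)].

Definition bihomogeneous d e (P : mpoly.mpoly (k.+1 + k.+1) R[i]) :=
  forall m, m \in mpoly.msupp P ->
    (\sum_(i < k.+1) m (lshift k.+1 i))%N = d /\
    (\sum_(i < k.+1) m (rshift k.+1 i))%N = e.

Definition bihomog_map (H : 'I_k.+1 -> mpoly.mpoly (k.+1 + k.+1) R[i])
    (p q : CP) : 'rV[R[i]]_k.+1 :=
  \row_i mpoly.meval (row_mx (hc p) (hc q) 0) (H i).

(* The same, for maps Z x Z -> CP. *)
Definition regular_map2 (Z : set CP) (phi : CP -> CP -> CP) :=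
  forall p q, Z p -> Z q ->
    exists d e (H : 'I_k.+1 -> mpoly.mpoly (k.+1 + k.+1) R[i]),
    [/\ forall i, bihomogeneous d e (H i),
        bihomog_map H p q != 0 &
        forall p' q', Z p' -> Z q' -> bihomog_map H p' q' != 0 ->
          phi p' q' = pt (bihomog_map H p' q')].

(* Affine coordinates on the complement of a hyperplane: for an invertible M,
   the linear forms L_j(v) = (v M)_j are a basis, the hyperplane is {L_0 = 0}
   and the coordinates are L_1 / L_0, ..., L_k / L_0. *)
Definition affine_part (M : 'M[R[i]]_k.+1) : set CP :=
  [set p | (hc p *m M) 0 0 != 0].

Definition affine_coord (M : 'M[R[i]]_k.+1) (j : 'I_k) (p : CP) : R[i] :=
  (hc p *m M) 0 (lift ord0 j) / (hc p *m M) 0 0.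

End ProjectiveSpace.

(* A g-dimensional projective group variety in CP^k.  The operations are total
   functions on CP^k, of which only the values on A matter. *)
Record abelian_variety (R : realType) (g k : nat) := AbelianVariety {
  av_set :> set (CP R k);
  av_zero : CP R k;
  av_add : CP R k -> CP R k -> CP R k;
  av_opp : CP R k -> CP R k;
  av_variety : projective_variety av_set;
  av_dimension : dimension av_set g;
  av_smooth : smooth av_set g;
  av_zero_in : av_set av_zero;
  av_add_in : forall p q, av_set p -> av_set q -> av_set (av_add p q);
  av_opp_in : forall p, av_set p -> av_set (av_opp p);
  av_addA : forall p q r, av_set p -> av_set q -> av_set r ->
    av_add p (av_add q r) = av_add (av_add p q) r;
  av_add0 : forall p, av_set p -> av_add av_zero p = p;
  av_addN : forall p, av_set p -> av_add (av_opp p) p = av_zero;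
  av_add_regular : regular_map2 av_set av_add;
  av_opp_regular : regular_map av_set av_opp
}.

(* The Z-span of an R-basis of C^g. *)
Definition lattice (R : realType) (g : nat) (Lambda : set 'rV[R[i]]_g) :=
  exists b : 'I_(2 * g) -> 'rV[R[i]]_g,
    (forall c : 'I_(2 * g) -> R,
       \sum_s (c s)%:C *: b s = 0 -> forall s, c s = 0) /\
    Lambda = [set z | exists m : 'I_(2 * g) -> int, z = \sum_s b s *~ m s].

(* A map to CP^k is holomorphic if it lifts locally to a holomorphic map to
   C^(k+1) minus the origin. *)
Definition holomorphic_to_CP (R : realType) (g k : nat)
    (f : 'rV[R[i]]_g -> CP R k) :=
  forall z : 'rV[R[i]]_g, exists F : 'rV[R[i]]_g -> 'rV[R[i]]_k.+1,
    \forall w \near z, [/\ differentiable F w, F w != 0 & f w = pt (F w)].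

(* A property holds near p in CP^k if it holds at pt u for u near hc p. The
   inverse A -> C^g / Lambda of the map induced by f is holomorphic if, near
   each point of A, it is the class modulo Lambda of (the restriction to A of) a
   holomorphic map G from an open subset of CP^k to C^g. *)
Definition holomorphic_inverse (R : realType) (g k : nat) (A : set (CP R k))
    (f : 'rV[R[i]]_g -> CP R k) :=
  forall p, A p -> exists G : CP R k -> 'rV[R[i]]_g,
    \forall u \near hc p, differentiable (G \o @pt R k) u /\
      (A (pt u) -> f (G (pt u)) = pt u).

(* f is the composition of the quotient map C^g -> C^g / Lambda with an
   isomorphism of complex Lie groups C^g / Lambda -> A. *)
Definition quotient_map (R : realType) (g k : nat)
    (Lambda : set 'rV[R[i]]_g) (A : abelian_variety R g k)
    (f : 'rV[R[i]]_g -> CP R k) :=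
  [/\ range f = A,
      forall z w, f (z + w) = av_add A (f z) (f w),
      forall z w, f z = f w <-> Lambda (z - w),
      holomorphic_to_CP f &
      holomorphic_inverse A f].

(* Main.v *)
Require Import Defs.
From HB Require Import structures.
From mathcomp Require Import all_boot all_order all_algebra.
From mathcomp Require Import all_classical all_reals all_analysis.
From mathcomp Require Import complex.
From mathcomp Require Import(canonicals, coercions, hints) mpoly.

Set Implicit Arguments.
Unset Strict Implicit.
Unset Printing Implicit Defensive.

Import Order.TTheory GRing.Theory Num.Theory.
Import numFieldNormedType.Exports.

Local Open Scope classical_set_scope.
Local Open Scope ring_scope.
Local Open Scope complex_scope.

(** The affine coordinates f_1, ..., f_k themselves form a Noetherian chain on
    the complement of the polar locus.  The point is that each partial
    derivative of f_j along C^g is an invariant derivation of A applied to a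
    regular function on the affine part of A, hence a polynomial in
    f_1, ..., f_k.

    Near a given point the derivative is a rational function of the f's.  The
    group law of A is given near (f z0, f 0) by bihomogeneous polynomials H, so
    if F is a holomorphic lift of f near 0 and h z is the vector of homogeneous
    coordinates of f z with first linear form equal to 1, the vector
    G = H (h z, F w) M satisfies G_0 f_j (z + w) = G_j for w near 0.
    Differentiating in w at w = 0 gives D d_i f_j = N, where D and N are
    polynomials in the values of the f's at z and D does not vanish at z0.  This
    holds at all z with f z in the affine part and not just near z0
    ([local_invariant_derivation]).

    These local formulas are glued by the Nullstellensatz.  The polynomials D
    for which every D (f) d_i f_j is polynomial in the f's form an ideal
    ([conductor_ideal]).  It has no zero in C^k ([conductor_no_zero]): a point
    of A is handled by the previous formula, because f maps onto A, and at
    a point outside A some equation of A does not vanish, while it vanishes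
    identically along f.  Hence 1 belongs to the ideal
    ([invariant_derivation_polynomial]).

    The Nullstellensatz is proved by an argument special to uncountable
    algebraically closed fields K.  Modulo a proper ideal J, some X_i - c is
    not invertible: otherwise the inverses of the X_i - c, for c in K, would be
    uncountably many elements of a space of countable dimension, and a linear
    relation between them, after clearing denominators, would put in J a nonzero
    polynomial in X_i, that is, up to a constant factor, a product of invertible
    elements.  Adding such an X_i - c to J for each i in turn yields a common
    zero ([proper_ideal_zero]). *)

Local Notation mX i := (mpoly.mpolyX _ (mpoly.mnm1 i)).

(** * Polynomials *)

Lemma mpoly_ring_ind (n : nat) (K : comNzRingType)
    (P : mpoly.mpoly n K -> Prop) :
  (forall c, P (mpoly.mpolyC n c)) -> (forall i, P (mX i)) ->
  (forall p q, P p -> P q -> P (p + q)) ->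
  (forall p q, P p -> P q -> P (p * q)) -> forall p, P p.
Proof.
move=> PC PX PD PM.
have P1 : P 1 by rewrite -mpoly.mpolyC1; exact: PC.
have PXn i e : P (mX i ^+ e).
  by elim: e => [|e Pe]; rewrite ?expr0 // exprS; exact: PM.
apply: mpoly.mpolyind => [|c m p _ _ Pp].
  by rewrite -(mpoly.mpolyC0 n K); exact: PC.
apply: PD => //; rewrite -mpoly.mul_mpolyC; apply: (PM) => //.
by rewrite mpoly.mpolyXE_id; apply: big_ind => // *; exact: PM.
Qed.

(** * The weak Nullstellensatz over an uncountable field *)

Section Nullstellensatz.
Variables (n : nat) (K : closedFieldType).
Hypothesis uncountableK : ~ countable [set: K].
Implicit Types (J : set (mpoly.mpoly n K)) (p q u : mpoly.mpoly n K).

Definition ideal J :=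
  (forall p q, J p -> J q -> J (p + q)) /\ (forall p q, J q -> J (p * q)).

(** The ideal J + (x). *)
Definition ideal_add J x : set (mpoly.mpoly n K) :=
  [set p | exists u, J (p - u * x)].

Lemma ideal_add_ideal J x : ideal J -> ideal (ideal_add J x).
Proof.
move=> [JD JM]; split=> p q.
  move=> [u Ju] [v Jv]; exists (u + v).
  by rewrite mulrDl opprD addrACA; exact: JD.
by move=> [u Ju]; exists (p * u); rewrite -mulrA -mulrBr; exact: JM.
Qed.

Lemma ideal_sum J (I : Type) (r : seq I) (P : pred I) F :
  ideal J -> J 0 -> (forall i, P i -> J (F i)) -> J (\sum_(i <- r | P i) F i).
Proof. by move=> [JD _] J0 JF; apply: big_ind. Qed.

(** The sets of c such that u c has size at most d cover K as d ranges over the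
    integers, so one of them is infinite: infinitely many of the u c lie in one
    finite-dimensional space. *)
Lemma uncountable_family_dependent (u : K -> mpoly.mpoly n K) :
  exists (N : nat) (c : 'I_N -> K) (v : 'I_N -> K),
    [/\ injective c, exists s, v s != 0 & \sum_s v s *: u (c s) = 0].
Proof.
pose deg (p : mpoly.mpoly n K) := mpoly.mmeasure (@mpoly.mdeg n) p.
have [d infd] : exists d, infinite_set [set c | (deg (u c) <= d)%N].
  apply: contrapT => /forallNP fin; apply: uncountableK.
  have -> : [set: K] = \bigcup_(d in [set: nat]) [set c | (deg (u c) <= d)%N].
    by rewrite eqEsubset; split=> // c _; exists (deg (u c)) => /=.
  apply: bigcup_countable => // d _; apply: finite_set_countable.
  by apply: contrapT; exact: fin.
pose I : finType := mpoly.bmultinom n d.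
have [B Bd sizeB] := infinite_set_fset #|I|.+1 infd.
pose s := finmap.enum_fset B; pose N := size s.
pose c (i : 'I_N) := nth 0 s i.
have deg_c i : (deg (u (c i)) <= d)%N by apply: Bd => /=; exact: mem_nth.
pose W := \matrix_(i < N, j < #|I|) mpoly.mcoeff (enum_val j : I) (u (c i)).
have /rowV0Pn[v vW v0] : kermx W != 0.
  rewrite kermx_eq0 /row_free neq_ltn; apply/orP; left.
  exact: leq_ltn_trans (rank_leq_col _) sizeB.
exists N, c, (fun i => v 0 i); split.
- move=> i j /eqP; rewrite nth_uniq // ?finmap.fset_uniq // => /eqP ij.
  exact/val_inj.
- by have /rV0Pn := v0.
apply/mpoly.mpolyP => m; rewrite mpoly.mcoeff0 raddf_sum /=.
under eq_bigr do rewrite mpoly.mcoeffZ.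
have [md|dm] := ltnP (mpoly.mdeg m) d; last first.
  apply: big1 => i _; rewrite mpoly.memN_msupp_eq0 ?mulr0 //.
  by apply: mpoly.msize_mdeg_ge; exact: leq_trans (deg_c i) dm.
have /sub_kermxP/rowP/(_ (enum_rank (mpoly.BMultinom md : I))) := vW.
rewrite !mxE => vWm; rewrite -[RHS]vWm; apply: eq_bigr => i _.
by rewrite mxE enum_rankK.
Qed.

Lemma ideal_cancel J p q u :
  ideal J -> J (u * q - 1) -> J (p * q) -> J p.
Proof.
move=> [JD JM] Juq Jpq; have -> : p = u * (p * q) + - p * (u * q - 1).
  by rewrite mulrBr mulr1 mulNr opprK addrA mulrCA addrN add0r.
by apply: JD; exact: JM.
Qed.

(** If every X_i - c had an inverse u c modulo J, a relation between the
    u (c_s) with coefficients v_s, multiplied by all the X_i - c_t, would put in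
    J the polynomial Q (X_i), where Q is the sum of the
    v_s \prod_(t != s) (X - c_t).  It is nonzero, having the value
    v_s \prod_(t != s) (c_s - c_t) at c_s, and it splits, so that its linear
    factors, invertible modulo J, can be cancelled one by one, until 1 is in
    J. *)
Lemma proper_ideal_add_root J (i : 'I_n) : ideal J -> J 0 -> ~ J 1 ->
  exists c : K, ~ ideal_add J (mX i - mpoly.mpolyC n c) 1.
Proof.
move=> idJ J0 J1; have [JD JM] := idJ.
apply: contrapT => /forallNP invJ.
have {invJ} /choice[u Ju] c : exists u, J (u * (mX i - mpoly.mpolyC n c) - 1).
  have /contrapT[u Ju] := invJ c; exists u.
  by rewrite -opprB -mulN1r; exact: JM.
have [N [c [v [injc [s0 vs0] vu0]]]] := uncountable_family_dependent u.
pose ev : {poly K} -> mpoly.mpoly n K := horner_alg (mX i).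
have evX a : ev ('X - a%:P) = mX i - mpoly.mpolyC n a.
  rewrite /ev rmorphB /= horner_algX horner_algC; congr (_ - _).
  by rewrite -mpoly.mul_mpolyC mulr1.
have evM (p q : {poly K}) : ev (p * q) = ev p * ev q by exact: rmorphM.
have evZ a (q : {poly K}) : ev (a *: q) = a *: ev q.
  by rewrite /ev -mul_polyC rmorphM /= horner_algC mulr_algl.
pose Q : {poly K} := \sum_s v s *: \prod_(t | t != s) ('X - (c t)%:P).
have Q_neq0 : Q != 0.
  apply: contraNneq vs0 => /(congr1 (horner^~ (c s0))).
  rewrite horner_sum horner0 (bigD1 s0) //=.
  rewrite [X in _ + X]big1 => [|s ss0]; last first.
    rewrite hornerZ horner_prod (bigD1 s0) 1?eq_sym //=.
    by rewrite hornerXsubC subrr mul0r mulr0.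
  rewrite addr0 hornerZ => /eqP; rewrite mulf_eq0 => /orP[//|].
  rewrite horner_prod => /prodf_eq0[t ts0].
  by rewrite hornerXsubC subr_eq0 => /eqP /injc ?; subst t; rewrite eqxx in ts0.
have JQ : J (ev Q).
  have Jprod : J (\sum_s v s *: (ev (\prod_(t | t != s) ('X - (c t)%:P)) *
                 (u (c s) * (mX i - mpoly.mpolyC n (c s)) - 1))).
    apply: ideal_sum => // s _; rewrite -mpoly.mul_mpolyC mulrA; exact: JM.
  rewrite -[ev Q]opprK -mulN1r; apply: JM.
  suff <- : \sum_s v s *: (ev (\prod_(t | t != s) ('X - (c t)%:P)) *
       (u (c s) * (mX i - mpoly.mpolyC n (c s)) - 1)) = - ev Q by [].
  (* The term added is a multiple of the relation between the u (c s). *)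
  have -> : - ev Q =
      ev (\prod_t ('X - (c t)%:P)) * (\sum_s v s *: u (c s)) - ev Q.
    by rewrite vu0 mulr0 sub0r.
  have -> : ev Q = \sum_s ev (v s *: \prod_(t | t != s) ('X - (c t)%:P)).
    exact: raddf_sum.
  rewrite mulr_sumr -sumrB; apply: eq_bigr => s _.
  rewrite evZ -scalerAr -scalerBr; congr (_ *: _).
  rewrite mulrBr mulr1; congr (_ - _).
  by rewrite [in RHS](bigD1 s) //= evM evX mulrA [LHS]mulrC mulrA.
have [r Qr] := closed_field_poly_normal Q.
apply: J1; move: JQ; rewrite {1}Qr evZ => JQ.
have : J (ev (\prod_(z <- r) ('X - z%:P))).
  set E := ev _ in JQ *.
  have -> : E = mpoly.mpolyC n (lead_coef Q)^-1 * (lead_coef Q *: E).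
    by rewrite mpoly.mul_mpolyC scalerA mulVf ?scale1r // lead_coef_eq0.
  exact: JM.
elim: {Qr JQ} r => [|z r IHr]; first by rewrite big_nil /ev rmorph1.
rewrite big_cons evM evX mulrC => /(ideal_cancel idJ (Ju z)).
exact: IHr.
Qed.

(** Enlarge J to a proper ideal J' that contains X_i - a_i for each i.  Modulo
    J' every polynomial is congruent to its value at a, so the value at a of an
    element of J is a constant in J', hence zero. *)
Lemma proper_ideal_zero J : ideal J -> J 0 -> ~ J 1 ->
  exists a : 'I_n -> K, forall p, J p -> mpoly.meval a p = 0.
Proof.
move=> idJ J0 J1.
have [J' [sJJ' idJ' J'1] J'c] : exists2 J', [/\ J `<=` J', ideal J' & ~ J' 1] &
    forall i, i \in enum 'I_n -> exists c, J' (mX i - mpoly.mpolyC n c).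
  elim: (enum 'I_n) => [|i s [J' [sJJ' idJ' J'1] J'c]].
    by exists J; [split|move=> i; rewrite in_nil].
  have [c J''1] := proper_ideal_add_root i idJ' (sJJ' _ J0) J'1.
  have sJ' : J' `<=` ideal_add J' (mX i - mpoly.mpolyC n c).
    by move=> p J'p; exists 0; rewrite mul0r subr0.
  exists (ideal_add J' (mX i - mpoly.mpolyC n c)).
    split=> //; first exact: subset_trans sJJ' sJ'.
    exact: ideal_add_ideal.
  move=> t; rewrite inE => /orP[/eqP ->|/J'c[e J'e]]; last first.
    by exists e; exact: sJ'.
  by exists c; exists 1; rewrite mul1r subrr; exact: sJJ' J0.
have /choice[a J'a] i : exists c, J' (mX i - mpoly.mpolyC n c).
  by apply: J'c; rewrite mem_enum.
have [J'D J'M] := idJ'.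
have J'eval p : J' (p - mpoly.mpolyC n (mpoly.meval a p)).
  elim/mpoly_ring_ind: p => [c|i|p q Jp Jq|p q Jp Jq].
  - by rewrite mpoly.mevalC subrr; exact: sJJ' J0.
  - by rewrite mpoly.mevalXU.
  - by rewrite mpoly.mevalD mpoly.mpolyCD opprD addrACA; exact: J'D.
  rewrite mpoly.mevalM mpoly.mpolyCM.
  set b := mpoly.mpolyC n _ in Jp *; set d := mpoly.mpolyC n _ in Jq *.
  have -> : p * q - b * d = q * (p - b) + b * (q - d).
    by rewrite !mulrBr [q * p]mulrC [q * b]mulrC addrA subrK.
  by apply: J'D; exact: J'M.
exists a => p Jp; apply: contrapT => /eqP pa0; apply: J'1.
rewrite -mpoly.mpolyC1 -(mulVf pa0) mpoly.mpolyCM; apply: (J'M).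
set b := mpoly.mpolyC n _.
have -> : b = p + -1 * (p - b) by rewrite mulN1r opprB addrC subrK.
by apply: J'D; [exact: sJJ'|exact: J'M].
Qed.

End Nullstellensatz.

Lemma uncountable_complex (R : realType) : ~ countable [set: R[i]].
Proof.
move=> /countable_injP[e inj_e].
have : countable `[0 : R, 1]%classic.
  apply/countable_injP; exists (fun x => e x%:C) => x y _ _ /inj_e exy.
  by have [] : x%:C = y%:C by apply: exy; rewrite inE.
move=> /countable_lebesgue_measure0/eqP.
by rewrite lebesgue_measure_itv /= lte_fin ltr01 oppr0 adde0 onee_eq0.
Qed.

(** * Polynomial functions *)

Definition polyfun (n : nat) (K : comNzRingType) (u : ('I_n -> K) -> K) :=
  exists P, forall a, u a = mpoly.meval a P.

Section PolynomialFunctions.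
Variables (n : nat) (K : comNzRingType).
Implicit Types (u v : ('I_n -> K) -> K).

Lemma polyfun_cst (c : K) : polyfun (fun _ : 'I_n -> K => c).
Proof. by exists (mpoly.mpolyC n c) => a; rewrite mpoly.mevalC. Qed.

Lemma polyfun_coord i : polyfun (fun a : 'I_n -> K => a i).
Proof. by exists (mX i) => a; rewrite mpoly.mevalXU. Qed.

Lemma polyfunD u v : polyfun u -> polyfun v -> polyfun (fun a => u a + v a).
Proof.
by move=> [P uP] [Q vQ]; exists (P + Q) => a; rewrite uP vQ mpoly.mevalD.
Qed.

Lemma polyfunM u v : polyfun u -> polyfun v -> polyfun (fun a => u a * v a).
Proof.
by move=> [P uP] [Q vQ]; exists (P * Q) => a; rewrite uP vQ mpoly.mevalM.
Qed.

Lemma polyfunB u v : polyfun u -> polyfun v -> polyfun (fun a => u a - v a).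
Proof.
by move=> [P uP] [Q vQ]; exists (P - Q) => a; rewrite uP vQ mpoly.mevalB.
Qed.

Lemma polyfun_sum (I : finType) (u : I -> ('I_n -> K) -> K) :
  (forall i, polyfun (u i)) -> polyfun (fun a => \sum_i u i a).
Proof.
move=> /choice[P uP]; exists (\sum_i P i) => a.
by rewrite raddf_sum; apply: eq_bigr => i _; exact: uP.
Qed.

Lemma polyfun_meval (m : nat) (y : 'I_m -> ('I_n -> K) -> K)
    (P : mpoly.mpoly m K) :
  (forall i, polyfun (y i)) ->
  polyfun (fun a => mpoly.meval (fun i => y i a) P).
Proof.
move=> /choice[Q yQ]; exists (mpoly.comp_mpoly [tuple Q i | i < m] P) => a.
rewrite mpoly.comp_mpoly_meval; apply: mpoly.meval_eq => i.
by rewrite tnth_mktuple yQ.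
Qed.

End PolynomialFunctions.

Lemma meval_homogeneous (R : realType) (k d : nat) (P : mpoly.mpoly k.+1 R[i])
    (c : R[i]) (v : 'I_k.+1 -> R[i]) : homogeneous_of d P ->
  mpoly.meval (fun i => c * v i) P = c ^+ d * mpoly.meval v P.
Proof.
move=> /mpoly.dhomogP homP; rewrite !mpoly.mevalE mulr_sumr.
apply: eq_big_seq => m /homP /= <-; rewrite mulrCA; congr (_ * _).
rewrite mpoly.mdegE -prodrXr -big_split /=.
by apply: eq_bigr => i _; rewrite exprMn.
Qed.

Lemma meval_bihomogeneous (R : realType) (k d e : nat)
    (P : mpoly.mpoly (k.+1 + k.+1) R[i]) (c c' : R[i])
    (u v : 'rV[R[i]]_k.+1) : bihomogeneous d e P ->
  mpoly.meval (row_mx (c *: u) (c' *: v) 0) P =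
  c ^+ d * c' ^+ e * mpoly.meval (row_mx u v 0) P.
Proof.
move=> homP; rewrite !mpoly.mevalE mulr_sumr.
apply: eq_big_seq => m /homP [<- <-]; rewrite mulrCA; congr (_ * _).
rewrite !big_split_ord /= -!prodrXr mulrACA -!big_split /=.
by apply: eq_bigr => i _; rewrite !row_mxEl !row_mxEr !mxE !exprMn.
Qed.

(** * The affine chart of projective space *)

Section Chart.
Variables (R : realType) (k : nat).
Implicit Types (v : 'rV[R[i]]_k.+1) (p : CP R k).

Lemma hc_pt v : v != 0 -> exists2 c, c != 0 & hc (pt v) = c *: v.
Proof. by move=> v0; apply/pt_eqP; rewrite ?hc_neq0 ?hcK. Qed.

Lemma pt_scale (c : R[i]) v : c != 0 -> v != 0 -> pt (c *: v) = pt v.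
Proof.
move=> c0 v0; apply/eqP/pt_eqP; rewrite ?scaler_eq0 ?negb_or ?c0 //.
by exists c.
Qed.

Variable M : 'M[R[i]]_k.+1.

Lemma affine_part_pt v : v != 0 ->
  affine_part M (pt v) <-> (v *m M) 0 0 != 0.
Proof.
move=> /hc_pt[c c0 E]; rewrite /affine_part /= E -scalemxAl mxE mulf_eq0.
by rewrite (negbTE c0).
Qed.

Lemma affine_coord_pt v j : v != 0 ->
  affine_coord M j (pt v) = (v *m M) 0 (lift ord0 j) / (v *m M) 0 0.
Proof.
move=> /hc_pt[c c0 E]; rewrite /affine_coord E -scalemxAl !mxE.
by rewrite -mulf_div divff // mul1r.
Qed.

(** The homogeneous coordinates of the point with affine coordinates a, scaled
    so that the linear form L_0 takes the value 1 on them; they are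
    polynomial in a. *)
Definition affine_lift (a : 'I_k -> R[i]) : 'rV[R[i]]_k.+1 :=
  (\row_i oapp a 1 (unlift ord0 i)) *m invmx M.

Lemma polyfun_affine_lift i : polyfun (fun a => affine_lift a 0 i).
Proof.
have -> : (fun a => affine_lift a 0 i) =
    fun a => \sum_m oapp a 1 (unlift ord0 m) * invmx M m i.
  by apply/funext => a; rewrite mxE; apply: eq_bigr => m _; rewrite mxE.
apply: polyfun_sum => m; apply: polyfunM; last exact: polyfun_cst.
by case: (unlift ord0 m) => [j|] /=; [exact: polyfun_coord|exact: polyfun_cst].
Qed.

Hypothesis unitM : M \in unitmx.

Lemma affine_liftM a i :
  (affine_lift a *m M) 0 i = oapp a 1 (unlift ord0 i).
Proof. by rewrite /affine_lift mulmxKV // mxE. Qed.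

Lemma affine_lift_neq0 a : affine_lift a != 0.
Proof.
apply/eqP => a0; have := affine_liftM a 0.
by rewrite a0 mul0mx mxE unlift_none /= => /esym/eqP; rewrite oner_eq0.
Qed.

Lemma affine_part_lift a : affine_part M (pt (affine_lift a)).
Proof.
apply/affine_part_pt; first exact: affine_lift_neq0.
by rewrite affine_liftM unlift_none oner_eq0.
Qed.

Lemma affine_coord_lift a j : affine_coord M j (pt (affine_lift a)) = a j.
Proof.
rewrite affine_coord_pt ?affine_lift_neq0 // !affine_liftM liftK unlift_none.
by rewrite divr1.
Qed.

Lemma affine_lift_coord p : affine_part M p ->
  p = pt (affine_lift (fun j => affine_coord M j p)).
Proof.
rewrite /affine_part /= => p0; rewrite -[LHS]hcK.
suff -> : hc p = (hc p *m M) 0 0 *: affine_lift (fun j => affine_coord M j p).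
  by rewrite pt_scale // affine_lift_neq0.
rewrite -[LHS](mulmxK unitM) /affine_lift scalemxAl; congr (_ *m _).
apply/rowP => i; rewrite !mxE; case: unliftP => [j ->|->] /=; last first.
  by rewrite mulr1.
by rewrite /affine_coord !mxE mulrC divfK //; rewrite mxE in p0.
Qed.

End Chart.

(** * Derivatives *)

Section Derivatives.
Variables (K : numFieldType) (V : normedModType K).

Lemma near_eq_differentiable (W : normedModType K) (f g : V -> W) (x : V) :
  (\near x, f x = g x) -> differentiable f x -> differentiable g x.
Proof.
move=> fg df; have [dfc dfE] := (diff_locallyP x f).1 df.
have gE : g \o shift x = cst (g x) + 'd f x +o_ 0 id.
  apply/eqaddoP => e e0; have /eqaddoP/(_ e e0) := dfE.
  rewrite -(nbhs_singleton fg).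
  have fg0 : \forall h \near 0, f (h + x) = g (h + x).
    rewrite (near_shift x) sub0r; near=> y.
    by rewrite /= subrK; near: y.
  by apply: filterS2 fg0 => h /= fgh; rewrite !fctE /= fgh.
by apply/diff_locallyP; rewrite (diff_unique dfc gE).
Unshelve. all: by end_near. Qed.

Lemma is_derive_translate (W : normedModType K) (f : V -> W) (z v : V) df :
  is_derive z v f df -> is_derive 0 v (fun w => f (z + w)) df.
Proof.
have E : (fun h : K => h^-1 *: (((fun w => f (z + w)) \o shift 0) (h *: v) -
      f (z + 0))) = (fun h => h^-1 *: ((f \o shift z) (h *: v) - f z)).
  by apply/funext => h /=; rewrite !addr0 [z + _]addrC.
by move=> [fd <-]; split; rewrite /derivable /derive E.
Qed.

Lemma is_derive_meval (n : nat) (y : 'I_n -> V -> K) (dy : 'I_n -> K)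
    (x v : V) (P : mpoly.mpoly n K) :
  (forall m, is_derive x v (y m) (dy m)) ->
  is_derive x v (fun w => mpoly.meval (y^~ w) P)
    (\sum_m mpoly.meval (y^~ x) (mpoly.mderiv m P) * dy m).
Proof.
move=> dyP; elim/mpoly_ring_ind: P => [c|i|p q dp dq|p q dp dq].
- under eq_fun do rewrite mpoly.mevalC.
  apply: is_derive_eq (is_derive_cst c x v) _.
  by rewrite big1 // => m _; rewrite mpoly.mderivC mpoly.meval0 mul0r.
- under eq_fun do rewrite mpoly.mevalXU.
  apply: is_derive_eq (dyP i) _; rewrite (bigD1 i) //= big1 => [|m mi].
    rewrite addr0 mpoly.mderivX mpoly.mnm1E eqxx scale1r.
    suff -> : mpoly.mpolyX K (mpoly.mnm_sub (mpoly.mnm1 i) (mpoly.mnm1 i)) = 1.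
      by rewrite mpoly.meval1 mul1r.
    rewrite -mpoly.mpolyX0; congr (mpoly.mpolyX _ _).
    by apply/mpoly.mnmP => j; rewrite mpoly.mnmBE subnn mpoly.mnm0E.
  rewrite mpoly.mderivX mpoly.mnm1E eq_sym (negbTE mi) scale0r.
  by rewrite mpoly.meval0 mul0r.
- under eq_fun do rewrite mpoly.mevalD.
  apply: is_derive_eq (is_deriveD dp dq) _; rewrite -big_split /=.
  by apply: eq_bigr => m _; rewrite mpoly.mderivD mpoly.mevalD mulrDl.
under eq_fun do rewrite mpoly.mevalM.
apply: is_derive_eq (is_deriveM dp dq) _; rewrite !scaler_sumr -big_split /=.
apply: eq_bigr => m _; rewrite mpoly.mderivM mpoly.mevalD !mpoly.mevalM mulrDl.
rewrite addrC /GRing.scale /=; congr (_ + _); last by rewrite mulrA.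
by rewrite mulrCA mulrA.
Qed.

End Derivatives.

(** * Invariant derivations of an abelian variety *)

Section Uniformization.
Variables (R : realType) (g k : nat) (A : abelian_variety R g k).
Variables (f : 'rV[R[i]]_g -> CP R k) (M : 'M[R[i]]_k.+1).
Hypothesis unitM : M \in unitmx.
Hypothesis rangef : range f = A.
Hypothesis fD : forall z w, f (z + w) = av_add A (f z) (f w).
Hypothesis holf : holomorphic_to_CP f.

Definition coords (z : 'rV[R[i]]_g) (j : 'I_k) := affine_coord M j (f z).

Lemma differentiable_entry (F : 'rV[R[i]]_g -> 'rV[R[i]]_k.+1) z i :
  differentiable F z -> differentiable (fun w => F w 0 i) z.
Proof.
move=> dF; pose entry (N : 'rV[R[i]]_k.+1) := N 0 i.
exact: (@differentiable_comp _ _ _ _ F entry z dF (differentiable_coord _ _ _)).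
Qed.

Lemma differentiable_linear_form (F : 'rV[R[i]]_g -> 'rV[R[i]]_k.+1) z i :
  differentiable F z -> differentiable (fun w => (F w *m M) 0 i) z.
Proof.
move=> dF; have -> : (fun w => (F w *m M) 0 i) =
    \sum_m ((fun w => F w 0 m) * cst (M m i)).
  by apply/funext => w; rewrite fct_sumE mxE.
apply: differentiable_sum => m; apply: differentiableM.
  exact: differentiable_entry.
exact: differentiable_cst.
Qed.

Lemma near_affine_part z : affine_part M (f z) ->
  \forall w \near z, affine_part M (f w).
Proof.
move=> Uz; have [F Fz] := holf z; have [dF F0 fF] := nbhs_singleton Fz.
have G0 : (F z *m M) 0 0 != 0 by apply/affine_part_pt; rewrite -?fF.
have := differentiable_continuous (differentiable_linear_form 0 dF).
move=> /cvgr_neq0/(_ G0) nearG0.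
near=> w; have [_ Fw0 ->] : [/\ differentiable F w, F w != 0 & f w = pt (F w)].
  by near: w.
by apply/affine_part_pt => //; near: w.
Unshelve. all: by end_near. Qed.

Lemma differentiable_coords z j : affine_part M (f z) ->
  differentiable (coords^~ j) z.
Proof.
move=> Uz; have [F Fz] := holf z; have [dF F0 fF] := nbhs_singleton Fz.
have G0 : (F z *m M) 0 0 != 0 by apply/affine_part_pt; rewrite -?fF.
pose G i := fun w => (F w *m M) 0 i.
have : differentiable (G (lift ord0 j) * (fun w => (G 0 w)^-1)) z.
  apply: differentiableM; first exact: differentiable_linear_form.
  by apply: differentiableV => //; exact: differentiable_linear_form.
apply: near_eq_differentiable; near=> w.
have [_ Fw0 fw] : [/\ differentiable F w, F w != 0 & f w = pt (F w)].
  by near: w.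
by rewrite /coords fw affine_coord_pt.
Unshelve. all: by end_near. Qed.


Definition bihomog_row (H : 'I_k.+1 -> mpoly.mpoly (k.+1 + k.+1) R[i])
    (u v : 'rV[R[i]]_k.+1) : 'rV[R[i]]_k.+1 :=
  \row_i mpoly.meval (row_mx u v 0) (H i).

Lemma bihomog_map_pt d e (H : 'I_k.+1 -> mpoly.mpoly (k.+1 + k.+1) R[i])
    (u v : 'rV[R[i]]_k.+1) : (forall i, bihomogeneous d e (H i)) ->
  u != 0 -> v != 0 ->
  exists2 c, c != 0 & bihomog_map H (pt u) (pt v) = c *: bihomog_row H u v.
Proof.
move=> homH /hc_pt[c c0 uE] /hc_pt[c' c'0 vE].
exists (c ^+ d * c' ^+ e); first by rewrite mulf_neq0 // expf_neq0.
apply/rowP => i; rewrite !mxE uE vE; exact: meval_bihomogeneous.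
Qed.

Definition partial_coord j i z := 'D_(delta_mx 0 i) (coords^~ j) z.

(** The vector G below represents f (z + w), for f z with affine coordinates a,
    as long as it is nonzero; where it vanishes, the relation
    G_0 f_j (z + w) = G_j is trivial.  So the relation holds for every z with
    f z in the affine part and every small w; its derivative at w = 0 is the
    formula sought, with D the value of G_0 at w = 0. *)
Lemma local_invariant_derivation z0 : affine_part M (f z0) ->
  exists (D : ('I_k -> R[i]) -> R[i])
    (N : 'I_k -> 'I_g -> ('I_k -> R[i]) -> R[i]),
  [/\ polyfun D, forall j i, polyfun (N j i), D (coords z0) != 0 &
      forall z j i, affine_part M (f z) ->
        D (coords z) * partial_coord j i z = N j i (coords z)].
Proof.
move=> Uz0; have Af z : av_set A (f z) by rewrite -rangef; exists z.
have f0 z : f z = av_add A (f z) (f 0) by rewrite -fD addr0.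
have [d [e [H [homH H0 addH]]]] := av_add_regular (Af z0) (Af 0).
have [F F0] := holf 0; have [dF F00 fF0] := nbhs_singleton F0.
pose y (a : 'I_k -> R[i]) m w : R[i] := row_mx (affine_lift M a) (F w) 0 m.
pose F' i := \row_l 'D_(delta_mx 0 i) (fun w => F w 0 l) 0.
pose dy (i : 'I_g) (m : 'I_(k.+1 + k.+1)) : R[i] :=
  row_mx (0 : 'rV_k.+1) (F' i) 0 m.
pose G a j w : R[i] := (bihomog_row H (affine_lift M a) (F w) *m M) 0 j.
pose dG a (i : 'I_g) (j : 'I_k.+1) := \sum_m (\sum_l
  mpoly.meval ((y a)^~ 0) (mpoly.mderiv l (H m)) * dy i l) * M m j.
have is_derive_y a m i : is_derive 0 (delta_mx 0 i) (y a m) (dy i m).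
  rewrite /y /dy; case: (split_ordP m) => l ->.
    under eq_fun do rewrite row_mxEl.
    rewrite row_mxEl [X in is_derive _ _ _ X]mxE; exact: is_derive_cst.
  under eq_fun do rewrite row_mxEr.
  rewrite row_mxEr [X in is_derive _ _ _ X]mxE; apply: derivableP.
  by apply: diff_derivable; exact: differentiable_entry.
have is_derive_G a j i : is_derive 0 (delta_mx 0 i) (G a j) (dG a i j).
  pose Hy m w := mpoly.meval ((y a)^~ w) (H m).
  have -> : G a j = \sum_m Hy m * cst (M m j).
    apply/funext => w; rewrite /G fct_sumE mxE.
    by apply: eq_bigr => m _; rewrite mxE.
  apply: is_derive_sum => m.
  have dHy := is_derive_meval (H m) (is_derive_y a ^~ i).
  apply: is_derive_eq (is_deriveM dHy (is_derive_cst _ _ _)) _.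
  by rewrite scaler0 add0r /GRing.scale /= mulrC.
have poly_y m w : polyfun (fun a => y a m w).
  rewrite /y; case: (split_ordP m) => l ->.
    under eq_fun do rewrite row_mxEl; exact: polyfun_affine_lift.
  under eq_fun do rewrite row_mxEr; exact: polyfun_cst.
have poly_G j : polyfun (fun a => G a j 0).
  have -> : (fun a => G a j 0) =
      fun a => \sum_m mpoly.meval ((y a)^~ 0) (H m) * M m j.
    by apply/funext => a; rewrite /G mxE; apply: eq_bigr => m _; rewrite mxE.
  apply: polyfun_sum => m; apply: polyfunM; last exact: polyfun_cst.
  exact: (@polyfun_meval _ _ _ (fun m a => y a m 0)).
have poly_dG i j : polyfun (fun a => dG a i j).
  apply: polyfun_sum => m; apply: polyfunM; last exact: polyfun_cst.
  apply: polyfun_sum => l; apply: polyfunM; last exact: polyfun_cst.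
  exact: (@polyfun_meval _ _ _ (fun m a => y a m 0)).
(* G_0 d_i f_j = d_i G_j - f_j d_i G_0, where everything is taken at w = 0. *)
exists (fun a => G a 0 0),
  (fun j i a => dG a i (lift ord0 j) - a j * dG a i 0).
have lift_f z : affine_part M (f z) -> f z = pt (affine_lift M (coords z)).
  exact: affine_lift_coord.
split=> //.
- move=> j i; apply: polyfunB => //; apply: polyfunM => //.
  exact: polyfun_coord.
- have := addH _ _ (Af z0) (Af 0) H0; rewrite -f0 => fz0.
  have a0 := affine_lift_neq0 unitM (coords z0).
  have [c c0 HE] := bihomog_map_pt homH a0 F00.
  rewrite -lift_f // -fF0 in HE; rewrite HE in fz0 H0.
  move: H0; rewrite scaler_eq0 (negbTE c0) /= => row0.
  by apply/affine_part_pt => //; rewrite -(pt_scale c0 row0) -fz0.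
move=> z j i Uz; set a := coords z.
have nearG : \forall w \near (0 : 'rV[R[i]]_g),
    G a 0 w * coords (z + w) j = G a (lift ord0 j) w.
  have nearU : \forall w \near (0 : 'rV[R[i]]_g), affine_part M (f (z + w)).
    have := near_affine_part Uz; rewrite (near_shift 0) subr0.
    by apply: filterS => w /=; rewrite addrC.
  near=> w.
  have [_ Fw0 fw] : [/\ differentiable F w, F w != 0 & f w = pt (F w)].
    by near: w.
  have Uzw : affine_part M (f (z + w)) by near: w.
  have [c c0 HE] := bihomog_map_pt homH (affine_lift_neq0 unitM a) Fw0.
  rewrite -lift_f // -fw in HE; rewrite /G.
  have [->|row0] := eqVneq (bihomog_row H (affine_lift M a) (F w)) 0.
    by rewrite mul0mx !mxE mul0r.
  have H1 : bihomog_map H (f z) (f w) != 0.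
    by rewrite HE scaler_eq0 negb_or c0.
  have fzw : f (z + w) = pt (bihomog_row H (affine_lift M a) (F w)).
    by rewrite fD addH // HE pt_scale.
  rewrite /coords fzw affine_coord_pt // mulrC divfK //.
  by apply/affine_part_pt => //; rewrite -fzw.
have dcoords : is_derive z (delta_mx 0 i) (coords^~ j) (partial_coord j i z).
  apply: derivableP; apply: diff_derivable; exact: differentiable_coords.
have := is_deriveM (is_derive_G a 0 i) (is_derive_translate dcoords).
move=> /(near_eq_is_derive nearG) [_ D1].
have [_ D2] := is_derive_G a (lift ord0 j) i.
by rewrite -D2 D1 addr0 /GRing.scale /= addrK.
Unshelve. all: by end_near. Qed.

(** The denominators D admissible in a formula that expresses all the partial
    derivatives of the f_j as fractions in the f's. *)
Definition conductor : set (mpoly.mpoly k R[i]) :=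
  [set D | forall j i, exists N : mpoly.mpoly k R[i],
    forall z, affine_part M (f z) ->
      mpoly.meval (coords z) D * partial_coord j i z =
      mpoly.meval (coords z) N].

Lemma conductor_ideal : ideal conductor.
Proof.
split=> p q => [Jp Jq|Jq] j i.
  have [[N pN] [N' qN]] := (Jp j i, Jq j i).
  exists (N + N') => z Uz.
  by rewrite !mpoly.mevalD mulrDl pN // qN.
have [N qN] := Jq j i; exists (p * N) => z Uz.
by rewrite !mpoly.mevalM -mulrA qN.
Qed.

Lemma conductor_no_zero a : exists2 D, conductor D & mpoly.meval a D != 0.
Proof.
have [Aa|nAa] := pselect (av_set A (pt (affine_lift M a))).
  move: Aa; rewrite -rangef => -[z0 _ fz0].
  have Uz0 : affine_part M (f z0) by rewrite fz0; exact: affine_part_lift.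
  have az0 : coords z0 = a.
    by apply/funext => j; rewrite /coords fz0 affine_coord_lift.
  have [D [N [[P DP] polyN Dz0 DN]]] := local_invariant_derivation Uz0.
  exists P => [j i|]; last by rewrite -DP -az0.
  by have [Q NQ] := polyN j i; exists Q => z Uz; rewrite -DP -NQ DN.
(* The point lies outside A: use an equation of A that excludes it. *)
have [[S homS AS] _] := av_variety A.
have [P SP aP] : exists2 P, S P & ~ vanishes P (pt (affine_lift M a)).
  apply: contrapT => noP; apply: nAa; rewrite AS => P SP.
  by apply: contrapT => aP; apply: noP; exists P.
have [d homP] := homS _ SP.
have vanishesE b : exists2 c, c != 0 &
    mpoly.meval (hc (pt (affine_lift M b)) 0) P =
    c * mpoly.meval (affine_lift M b 0) P.
  have [c c0 ->] := hc_pt (affine_lift_neq0 unitM b).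
  exists (c ^+ d); first exact: expf_neq0.
  rewrite -meval_homogeneous //; apply: mpoly.meval_eq => i; exact: mxE.
have [Q PQ] := polyfun_meval P (polyfun_affine_lift M).
exists Q => [j i|].
  exists 0 => z Uz; rewrite mpoly.meval0 -PQ.
  have : vanishes P (f z).
    have : av_set A (f z) by rewrite -rangef; exists z.
    by rewrite AS => /(_ _ SP).
  rewrite (affine_lift_coord unitM Uz) /vanishes.
  have [c c0 ->] := vanishesE (coords z).
  by move=> /eqP; rewrite mulf_eq0 (negbTE c0) => /eqP ->; rewrite mul0r.
have [c c0 cP] := vanishesE a.
apply/eqP => aQ; apply: aP; rewrite /vanishes cP.
by rewrite PQ aQ mulr0.
Qed.

Lemma invariant_derivation_polynomial :
  exists N : 'I_k -> 'I_g -> mpoly.mpoly k R[i],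
    forall j i z, affine_part M (f z) ->
      partial_coord j i z = mpoly.meval (coords z) (N j i).
Proof.
have J1 : conductor 1.
  apply: contrapT => /(proper_ideal_zero (@uncountable_complex R)
    conductor_ideal)-/(_ _)[|a aJ].
    have [D JD _] := conductor_no_zero (fun=> 0).
    by rewrite -(mul0r D); exact: conductor_ideal.2.
  by have [D /aJ ->] := conductor_no_zero a; rewrite eqxx.
have /choice[N NP] (ji : 'I_k * 'I_g) : exists N : mpoly.mpoly k R[i],
    forall z, affine_part M (f z) ->
      partial_coord ji.1 ji.2 z = mpoly.meval (coords z) N.
  have [N NP] := J1 ji.1 ji.2; exists N => z Uz.
  by rewrite -NP // mpoly.meval1 mul1r.
by exists (fun j i => N (j, i)) => j i z Uz; rewrite -(NP (j, i)).
Qed.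

End Uniformization.

(** * The Noetherian chain of the affine coordinates *)

Theorem mainTheorem5 (R : realType) (g k : nat) (A : abelian_variety R g k)
    (Lambda : set 'rV[R[i]]_g) (f : 'rV[R[i]]_g -> CP R k)
    (M : 'M[R[i]]_k.+1) :
  lattice Lambda -> quotient_map Lambda A f -> M \in unitmx ->
  forall (j : 'I_k) (Omega : set 'rV[R[i]]_g),
    bounded_domain Omega ->
    closure Omega `<=` f @^-1` (A `&` affine_part M) ->
    noetherian_function Omega (affine_coord M j \o f).
Proof.
move=> _ [rangef fD _ holf _] unitM j Omega _ subOmega.
have U z : Omega z -> affine_part M (f z).
  by move=> /subset_closure/subOmega[].
have [N NP] := invariant_derivation_polynomial unitM rangef fD holf.
(* A polynomial in the f's, seen as a polynomial in z and the f's. *)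
have eval_shift (P : mpoly.mpoly k R[i]) : exists Q : mpoly.mpoly (g + k) R[i],
    forall z, mpoly.meval (coords f M z) P =
      eval_with (fun j z => coords f M z j) Q z.
  have [Q PQ] := polyfun_meval P (fun j => polyfun_coord R[i] (rshift g j)).
  exists Q => z; rewrite /eval_with -PQ; apply: mpoly.meval_eq => i.
  by rewrite row_mxEr mxE.
exists k, (fun j z => coords f M z j).
have [Q jQ] := eval_shift (mX j); exists Q; split; last first.
  by move=> z Oz; rewrite -jQ mpoly.mevalXU.
split=> [i z Oz|]; first exact: differentiable_coords (U z Oz).
have /choice[P PP] := fun il : 'I_k * 'I_g => eval_shift (N il.1 il.2).
exists (fun i l => P (i, l)) => i l z Oz.
by rewrite -(PP (i, l)) /= -NP; last exact: U Oz.
Qed.
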